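(* Let $\mathcal X$ be a set, $\mathcal Y$ a real Hilbert space, and $\mathcal H$ a vector-valued RKHS of operators $\mathcal X\to\mathcal Y$ with feature maps $\Phi(x)\in\mathcal L(\mathcal Y,\mathcal H)$ and bounded operator-valued kernel $K:\mathcal X\times\mathcal X\to\mathcal L(\mathcal Y)$. Assume: (i) $\mathcal H$ is normal: for every $x\in\mathcal X$, $\Phi(x)y=0$ implies $y=0$; (ii) for every finite tuple of pairwise distinct inputs, the associated kernel operator $K_{XX}$ is invertible, equivalently there is $c>0$ with $\|K_{XX}\boldsymbol z\|_{\mathcal Y^m}\ge c\|\boldsymbol z\|_{\mathcal Y^m}$ for all $\boldsymbol z\in\mathcal Y^m$, where $m$ is the number of inputs; (iii) $f\in\mathcal H$ with $\|f\|_{\mathcal H}\le\Gamma$, where $\Gamma$ is a known constant. Let $m\in\mathbb N$, let $X=(x_1,\dots,x_m)$ be pairwise distinct points of $\mathcal X$, and let $y_i=f(x_i)+\delta_i$, where $\delta_i\in\mathcal Y$ satisfies $\|\delta_i\|_{\mathcal Y}\le\bar\delta$ for all $i\in\{1,\dots,m\}$, with $\bar\delta$ a known constant. Put $\boldsymbol y=(y_1,\dots,y_m)\in\mathcal Y^m$. Let $\lambda>0$ and let $s^*\in\mathcal H$ be the kernel ridge regression solution $$s^*=\arg\min_{s\in\mathcal H}\ \sum_{i=1}^m\|s(x_i)-y_i\|_{\mathcal Y}^2+\lambda\|s\|_{\mathcal H}^2,$$ which is given explicitly by $s^*(x)=K_{xX}(K_{XX}+\lambda I)^{-1}\boldsymbol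 y$. Then for every $x\in\mathcal X$, $$\|s^*(x)-f(x)\|_{\mathcal Y}\le\|P^{1/2}(x)\|\sqrt{\Gamma^2+\Delta-\|\hat s\|_{\mathcal H}^2}+\nabla+\Big\|K_{xX}\big((K_{XX}+\lambda I)^{-1}-K_{XX}^{-1}\big)\boldsymbol y\Big\|_{\mathcal Y}.$$ Here: - $P^{1/2}(x)$ is the positive square root of $P(x)=K(x,x)-K_{xX}K_{XX}^{-1}K_{Xx}$, and $\|P^{1/2}(x)\|$ is its operator norm; - $\hat s\in\mathcal H$ is the minimum-norm interpolant of the noisy measurements, $\hat s(\cdot)=K_{\cdot X}K_{XX}^{-1}\boldsymbol y$; - $\Delta$ is the optimal value (supremum) of $$2\langle\boldsymbol\eta,K_{XX}^{-1}\boldsymbol y\rangle_{\mathcal Y^m}-\langle\boldsymbol\eta,K_{XX}^{-1}\boldsymbol\eta\rangle_{\mathcal Y^m}$$ over all $\boldsymbol\eta=(\eta_1,\dots,\eta_m)\in\mathcal Y^m$ with $\|\eta_i\|_{\mathcal Y}\le\bar\delta$ for all $i$; - $\nabla$ (a number depending on $x$) is the optimal value (supremum) of $\|K_{xX}K_{XX}^{-1}\boldsymbol\eta\|_{\mathcal Y}$ over the same set of $\boldsymbol\eta$.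
   Context: $\mathcal L(\mathcal Y_1,\mathcal Y_2)$ denotes the bounded linear operators between Hilbert spaces, and $\mathcal L(\mathcal Y)=\mathcal L(\mathcal Y,\mathcal Y)$. $T^*$ denotes the adjoint of $T$. $\mathcal Y^m$ is the Hilbert-space direct sum of $m$ copies of $\mathcal Y$, and $I$ is the identity on $\mathcal Y^m$. A Hilbert space $\mathcal H$ of maps $\mathcal X\to\mathcal Y$ is a vector-valued RKHS if for all $y\in\mathcal Y$ and $x\in\mathcal X$ the linear functional $f\mapsto\langle y,f(x)\rangle_{\mathcal Y}$ is continuous on $\mathcal H$. Then for each $x$ there is $\Phi(x)\in\mathcal L(\mathcal Y,\mathcal H)$ with $\langle\Phi(x)y,f\rangle_{\mathcal H}=\langle y,f(x)\rangle_{\mathcal Y}$ for all $f\in\mathcal H$, $y\in\mathcal Y$. The operator-valued kernel is $K(x,t)y=(\Phi(t)y)(x)$. Equivalently, $\langle y,K(x,t)z\rangle_{\mathcal Y}=\langle\Phi(x)y,\Phi(t)z\rangle_{\mathcal H}$ for all $y,z\in\mathcal Y$. In particular $K(x,t)=K(t,x)^*$ and $K(x,x)$ is positive semidefinite. The kernel is bounded if $\sup_{x\in\mathcal X}\|K(x,x)\|<\infty$. Given pairwise distinct inputs $X=(x_1,\dots,x_m)$ and $x\in\mathcal X$: - $K_{XX}\in\mathcal L(\mathcal Y^m)$ is defined by $(K_{XX}\boldsymbol z)_i=\sum_{j=1}^mK(x_i,x_j)z_j$; - $K_{Xx}\in\mathcal L(\mathcal Y,\mathcal Y^m)$ is defined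 by $(K_{Xx}y)_i=K(x_i,x)y$; - $K_{xX}=K_{Xx}^*\in\mathcal L(\mathcal Y^m,\mathcal Y)$, so that $K_{xX}\boldsymbol z=\sum_{i=1}^mK(x,x_i)z_i$. The minimum-norm interpolant of the noisy measurements is the element of smallest $\mathcal H$-norm among those $s\in\mathcal H$ with $s(x_i)=y_i$ for all $i$. Its norm satisfies $\|\hat s\|_{\mathcal H}^2=\langle\boldsymbol y,K_{XX}^{-1}\boldsymbol y\rangle_{\mathcal Y^m}$. *)

(* Defs.v *)
From HB Require Import structures.
From mathcomp Require Import all_boot all_order all_algebra.
From mathcomp Require Import all_classical all_reals all_analysis.
From mathcomp Require Import ring lra.

Set Implicit Arguments.
Unset Strict Implicit.
Unset Printing Implicit Defensive.

Import Order.TTheory GRing.Theory Num.Theory.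
Import numFieldNormedType.Exports.

Local Open Scope classical_set_scope.
Local Open Scope ring_scope.

HB.mixin Record CompleteNormedModule_isHilbert (R : realType) V
    & CompleteNormedModule R V := {
  inner : V -> V -> R ;
  innerC : forall u v, inner u v = inner v u ;
  innerPl : forall a u v w,
    inner (a *: u + v) w = a * inner u w + inner v w ;
  innerE : forall u, inner u u = `|u| ^+ 2
}.

#[short(type="hilbertType")]
HB.structure Definition Hilbert (R : realType) :=
  {V of CompleteNormedModule R V & CompleteNormedModule_isHilbert R V}.

Lemma semi_inner_expand (R : realType) (V : lmodType R) (b : V -> V -> R)
    (bC : forall u v, b u v = b v u)
    (bP : forall a u v w, b (a *: u + v) w = a * b u w + b v w) a u v :
  b (a *: u + v) (a *: u + v) = a ^+ 2 * b u u + 2 * a * b u v + b v v.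
Proof. by rewrite bP (bC u) (bC v (a *: u + v)) !bP (bC v u); ring. Qed.

Lemma semi_cauchy_schwarz (R : realType) (V : lmodType R) (b : V -> V -> R)
    (bC : forall u v, b u v = b v u)
    (bP : forall a u v w, b (a *: u + v) w = a * b u w + b v w)
    (b_ge0 : forall u, 0 <= b u u) u v :
  b u v <= Num.sqrt (b u u) * Num.sqrt (b v v).
Proof.
have key a : 0 <= a ^+ 2 * b u u + 2 * a * b u v + b v v.
  by rewrite -semi_inner_expand.
rewrite -sqrtrM//.
apply: (le_trans (ler_norm _)); rewrite -sqrtr_sqr; apply: ler_wsqrtr.
move: (b u u) (b v v) (b u v) (b_ge0 u) (b_ge0 v) key => A C B A0 C0 key.
have [A_eq|nz] := eqVneq A 0.
  have [->|Bnz] := eqVneq B 0; first by rewrite A_eq mul0r expr0n.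
  have := key (- (C + 1) / (2 * B)); rewrite A_eq mulr0 add0r.
  have -> : 2 * (- (C + 1) / (2 * B)) * B = - (C + 1) by field.
  by move=> h; exfalso; lra.
have Ap : 0 < A by rewrite lt_neqAle eq_sym nz.
have := key (- B / A).
have -> : (- B / A) ^+ 2 * A + 2 * (- B / A) * B + C = (A * C - B ^+ 2) / A.
  by field.
by rewrite pmulr_lge0 ?invr_gt0// subr_ge0.
Qed.

(* The alias carries the l2 norm, so that no norm is put on {ffun 'I_m -> Y}. *)
Section hilbert_sum.
Variables (R : realType) (Y : hilbertType R) (m : nat).

Definition hilbert_sum : Type := {ffun 'I_m -> Y}.

HB.instance Definition _ := GRing.Lmodule.copy hilbert_sum {ffun 'I_m -> Y}.

Definition hsum_inner (z w : hilbert_sum) : R := \sum_i inner (z i) (w i).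
Definition hsum_norm (z : hilbert_sum) : R := Num.sqrt (\sum_i `|z i| ^+ 2).

Lemma hsum_innerC z w : hsum_inner z w = hsum_inner w z.
Proof. by apply: eq_bigr => i _; rewrite innerC. Qed.

Lemma hsum_innerPl a u v w :
  hsum_inner (a *: u + v) w = a * hsum_inner u w + hsum_inner v w.
Proof.
rewrite /hsum_inner mulr_sumr -big_split; apply: eq_bigr => i _ /=.
by rewrite !ffunE innerPl.
Qed.

Lemma hsum_inner_norm u : hsum_inner u u = hsum_norm u ^+ 2.
Proof.
rewrite sqr_sqrtr; last by apply: sumr_ge0 => i _; rewrite exprn_ge0.
by apply: eq_bigr => i _; rewrite innerE.
Qed.

Let hsum_norm_sqrt u : hsum_norm u = Num.sqrt (hsum_inner u u).
Proof. by rewrite hsum_inner_norm sqrtr_sqr ger0_norm// sqrtr_ge0. Qed.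

Lemma hsum_normD u v : hsum_norm (u + v) <= hsum_norm u + hsum_norm v.
Proof.
have nn w : 0 <= hsum_norm w by exact: sqrtr_ge0.
rewrite -(@ler_pXn2r _ 2)// ?nnegrE ?addr_ge0//.
rewrite -hsum_inner_norm -{1 2}[u]scale1r.
rewrite (semi_inner_expand hsum_innerC hsum_innerPl) !hsum_inner_norm.
have := semi_cauchy_schwarz hsum_innerC hsum_innerPl _ u v.
rewrite -!hsum_norm_sqrt => /(_ _)/wrap[].
  by move=> w; rewrite hsum_inner_norm exprn_ge0.
by move=> h; rewrite sqrrD; lra.
Qed.

Lemma hsum_normZ a u : hsum_norm (a *: u) = `|a| * hsum_norm u.
Proof.
rewrite /hsum_norm -(sqrtr_sqr a) -sqrtrM ?sqr_ge0//.
rewrite mulr_sumr; congr Num.sqrt; apply: eq_bigr => i _.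
by rewrite ffunE normrZ exprMn real_normK ?num_real.
Qed.

Lemma hsum_norm_ge (z : hilbert_sum) i : `|z i| <= hsum_norm z.
Proof.
rewrite -[leLHS]normr_id -sqrtr_sqr; apply: ler_wsqrtr.
by rewrite (bigD1 i)//= lerDl sumr_ge0// => j _; rewrite exprn_ge0.
Qed.

Lemma hsum_norm0_eq0 z : hsum_norm z = 0 -> z = 0.
Proof.
move=> z0; apply/ffunP => i; rewrite ffunE; apply/normr0_eq0/eqP.
by rewrite eq_le normr_ge0 andbT -z0 hsum_norm_ge.
Qed.

HB.instance Definition _ := Lmodule_isNormed.Build R hilbert_sum
  hsum_normD hsum_normZ hsum_norm0_eq0.

Lemma hsum_norm_lt (e : R) (z : hilbert_sum) :
  0 < e -> (forall i, `|z i| < e / m.+1%:R) -> `|z| < e.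
Proof.
move=> e0 ze; rewrite [ltLHS](_ : _ = hsum_norm z)//.
rewrite -(@ltr_pXn2r _ 2)// ?nnegrE ?sqrtr_ge0 ?(ltW e0)//.
rewrite sqr_sqrtr; last by apply: sumr_ge0 => i _; rewrite exprn_ge0.
apply: (@le_lt_trans _ _ (\sum_(i < m) (e / m.+1%:R) ^+ 2)).
  apply: ler_sum => i _; apply: lerXn2r; rewrite ?nnegrE//; last exact: ltW.
  by rewrite divr_ge0// ltW.
rewrite sumr_const card_ord -[ltLHS]mulr_natr exprMn exprVn -mulrA gtr_pMr ?exprn_gt0//.
rewrite mulrC ltr_pdivrMr ?exprn_gt0// mul1r -natrX ltr_nat.
by rewrite (@leq_trans m.+1)// leq_pmulr.
Qed.

Lemma hilbert_sum_complete (F : set_system hilbert_sum) :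
  ProperFilter F -> cauchy F -> cvg F.
Proof.
move=> FF /cauchyP Fc; apply/cvg_ex.
have Fi (i : 'I_m) : cvg ((fun z : hilbert_sum => z i) @ F).
  apply: cauchy_cvg; apply/cauchyP => e e0; have [z Fz] := Fc e e0.
  exists (z i); rewrite /= nbhs_simpl; apply: filterS Fz => w.
  rewrite -!ball_normE/= => /(le_lt_trans _); apply.
  by have := hsum_norm_ge (z - w) i; rewrite !ffunE.
exists ([ffun i => lim ((fun z : hilbert_sum => z i) @ F)] : hilbert_sum).
apply/cvgrPdist_lt => e e0.
have e1 : 0 < e / m.+1%:R by rewrite divr_gt0.
have : F [set z : hilbert_sum | forall i : 'I_m,
    `|lim ((fun z : hilbert_sum => z i) @ F) - z i| < e / m.+1%:R].
  apply: filter_forall => i; have /cvgrPdist_lt := Fi i; exact.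
apply: filterS => z h; apply: hsum_norm_lt => // i.
by rewrite !ffunE; apply: h.
Qed.

HB.instance Definition _ := Uniform_isComplete.Build hilbert_sum
  hilbert_sum_complete.

HB.instance Definition _ := CompleteNormedModule_isHilbert.Build R hilbert_sum
  hsum_innerC hsum_innerPl hsum_inner_norm.

End hilbert_sum.

Definition bounded_op (R : realType) (U V : hilbertType R) (A : U -> V) : Prop :=
  linear A /\ continuous A.

(* A real supremum, hence meaningful for bounded operators only. *)
Definition opnorm (R : realType) (U V : hilbertType R) (A : U -> V) : R :=
  sup [set `|A u| | u in [set u | `|u| <= 1]].

Definition is_inverse_op (R : realType) (U V : hilbertType R)
    (A : U -> V) (B : V -> U) : Prop :=
  [/\ bounded_op B, cancel A B & cancel B A].

Definition invertible_op (R : realType) (U V : hilbertType R) (A : U -> V) :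
  Prop := exists B, is_inverse_op A B.

(* get picks an element of the set when there is one, and a default value
   otherwise; inverses and positive square roots are unique. *)
Definition inv_op (R : realType) (U V : hilbertType R) (A : U -> V) : V -> U :=
  get [set B | is_inverse_op A B].

(* Over the reals, symmetry does not follow from the sign of the quadratic form. *)
Definition positive_op (R : realType) (V : hilbertType R) (A : V -> V) : Prop :=
  [/\ bounded_op A, (forall u v, inner (A u) v = inner u (A v)) &
      forall u, 0 <= inner (A u) u].

Definition sqrt_op (R : realType) (V : hilbertType R) (A : V -> V) : V -> V :=
  get [set B | positive_op B /\ forall v, B (B v) = A v].

(* The elements of H are functions T -> Y: evaluation embeds H, as a vector
   space, into the space of all functions. *)
Record rkhs (R : realType) (T : Type) (Y H : hilbertType R) := RKHS {
  eval :> H -> T -> Y ;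
  eval_linear : forall a f g x, eval (a *: f + g) x = a *: eval f x + eval g x ;
  eval_inj : injective eval ;
  eval_continuous : forall x y, continuous (fun f : H => inner y (eval f x) : R)
}.

Section kernel_operators.
Variables (R : realType) (T : Type) (Y H : hilbertType R) (E : rkhs T Y H).

Definition feature_map (Phi : T -> Y -> H) : Prop :=
  forall x, bounded_op (Phi x) /\
    forall y f, inner (Phi x y) f = inner y (E f x).

Definition kernel_of (Phi : T -> Y -> H) (x t : T) : Y -> Y :=
  fun y => E (Phi t y) x.

Definition bounded_kernel (K : T -> T -> Y -> Y) : Prop :=
  has_ubound [set opnorm (K x x) | x in [set: T]].

Variables (K : T -> T -> Y -> Y) (m : nat) (X : 'I_m -> T).

Definition KXX (z : hilbert_sum Y m) : hilbert_sum Y m :=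
  [ffun i => \sum_j K (X i) (X j) (z j)].

Definition KXx (x : T) (y : Y) : hilbert_sum Y m := [ffun i => K (X i) x y].

Definition KxX (x : T) (z : hilbert_sum Y m) : Y := \sum_i K x (X i) (z i).

Definition power_op (x : T) (y : Y) : Y :=
  K x x y - KxX x (inv_op KXX (KXx x y)).

Definition krr_cost (lambda : R) (y : hilbert_sum Y m) (s : H) : R :=
  \sum_i `|E s (X i) - y i| ^+ 2 + lambda * `|s| ^+ 2.

Definition is_krr_solution (lambda : R) (y : hilbert_sum Y m) (s : H) : Prop :=
  forall s', krr_cost lambda y s <= krr_cost lambda y s'.

Definition interpolates (y : hilbert_sum Y m) (s : H) : Prop :=
  forall i, E s (X i) = y i.

Definition is_min_norm_interpolant (y : hilbert_sum Y m) (s : H) : Prop :=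
  interpolates y s /\ forall s', interpolates y s' -> `|s| <= `|s'|.

Definition noise_set (dbar : R) : set (hilbert_sum Y m) :=
  [set eta | forall i, `|eta i| <= dbar].

Definition Delta (dbar : R) (y : hilbert_sum Y m) : R :=
  sup [set 2 * inner eta (inv_op KXX y) - inner eta (inv_op KXX eta)
      | eta in noise_set dbar].

Definition Nabla (dbar : R) (x : T) : R :=
  sup [set `|KxX x (inv_op KXX eta)| | eta in noise_set dbar].

End kernel_operators.

Lemma kernel_ofE (R : realType) (T : Type) (Y H : hilbertType R)
    (E : rkhs T Y H) (Phi : T -> Y -> H) (x t : T) (y z : Y) :
  feature_map E Phi ->
  inner y (kernel_of E Phi x t z) = inner (Phi x y) (Phi t z).
Proof. by move=> /(_ x)[_ ->]. Qed.

Lemma KxX_adjoint (R : realType) (T : Type) (Y H : hilbertType R)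
    (E : rkhs T Y H) (Phi : T -> Y -> H) (m : nat) (X : 'I_m -> T) (x : T)
    (z : hilbert_sum Y m) (y : Y) :
  feature_map E Phi ->
  inner z (KXx (kernel_of E Phi) X x y) = inner (KxX (kernel_of E Phi) X x z) y.
Proof.
move=> Phi_feature.
have inner_suml (I : finType) (F : I -> Y) :
    inner (\sum_i F i) y = \sum_i inner (F i) y.
  apply: (big_morph (fun u => inner u y)) => [u v|].
    by rewrite -[u]scale1r innerPl scale1r mul1r.
  have := innerPl (-1) (0 : Y) 0 y.
  by rewrite scaler0 addr0 mulN1r addNr.
rewrite /KxX inner_suml; apply: eq_bigr => i _; rewrite ffunE.
by rewrite [RHS]innerC !kernel_ofE// innerC.
Qed.

(* Main.v *)
Require Import Defs.
From HB Require Import structures.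
From mathcomp Require Import all_boot all_order all_algebra.
From mathcomp Require Import all_classical all_reals all_analysis.
From mathcomp Require Import ring lra.

Set Implicit Arguments.
Unset Strict Implicit.
Unset Printing Implicit Defensive.

Import Order.TTheory GRing.Theory Num.Theory.
Import numFieldNormedType.Exports.

Local Open Scope classical_set_scope.
Local Open Scope ring_scope.

(** Let [sample s] be the vector of values of [s] at the inputs and [combine z]
    the sum of the features [Phi (X i) (z i)]. The reproducing property makes
    [combine] the adjoint of [sample], and [KXX] is [sample \o combine], hence
    positive; evaluating [combine z] at [x] gives [KxX x z].

    Both fits are of the form [combine z]. The ridge cost is quadratic, so its
    derivative in every direction vanishes at a minimizer [s]; read through the
    adjunction, this says [lambda s = combine (y - sample s)]
    ([krr_solutionE]). Likewise [combine (KXX^-1 y)] interpolates [y] and is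
    orthogonal to every function that vanishes at the inputs, so Pythagoras
    makes it the only interpolant of least norm ([min_norm_interpolantE]).

    For the error bound let [residual s = s - combine (KXX^-1 (sample s))], the
    orthogonal projection onto the functions that vanish at the inputs, and
    write [d = y - sample f] for the noise. By linearity of [KXX^-1]

      [sstar x - f x = - residual f x + KxX (KXX^-1 d) + KxX (Kreg y - KXX^-1 y)].

    The second term is at most [Nabla]. For the first, [P x] is the Gram
    operator of the projected features:
    [<P u, v> = <residual (Phi x u), residual (Phi x v)>] ([inner_power_op]).
    So [|P^(1/2) v| = |residual (Phi x v)|], and Cauchy-Schwarz bounds [|g x|] by
    [|P^(1/2)| |g|] for every [g] that vanishes at the inputs
    ([eval_le_power]). Finally
    [|residual f|^2 = |f|^2 - <y - d, KXX^-1 (y - d)>], and expanding the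
    square produces the objective of [Delta] at [d] ([residual_energy]).

    Two facts of operator theory support this: a positive bounded operator has
    a positive square root ([positive_op_sqrt]), without which [sqrt_op] would
    be a default value, and a positive operator plus a positive multiple of the
    identity is invertible ([positive_op_shift_invertible]). *)

(** * Inner products *)

Section inner_product.
Variables (R : realType) (V : hilbertType R).
Implicit Types u v w : V.

Lemma innerDl u v w : inner (u + v) w = inner u w + inner v w.
Proof. by rewrite -{1}[u]scale1r innerPl mul1r. Qed.

Lemma inner0l w : inner 0 w = 0.
Proof. by have := innerDl 0 0 w; rewrite addr0; lra. Qed.

Lemma innerZl a u w : inner (a *: u) w = a * inner u w.
Proof. by rewrite -[a *: u]addr0 innerPl inner0l addr0. Qed.

Lemma innerNl u w : inner (- u) w = - inner u w.
Proof. by rewrite -scaleN1r innerZl mulN1r. Qed.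

Lemma innerBl u v w : inner (u - v) w = inner u w - inner v w.
Proof. by rewrite innerDl innerNl. Qed.

Lemma innerDr u v w : inner w (u + v) = inner w u + inner w v.
Proof. by rewrite innerC innerDl !(innerC w). Qed.

Lemma innerZr a u w : inner w (a *: u) = a * inner w u.
Proof. by rewrite innerC innerZl (innerC w). Qed.

Lemma innerNr u w : inner w (- u) = - inner w u.
Proof. by rewrite innerC innerNl (innerC w). Qed.

Lemma innerBr u v w : inner w (u - v) = inner w u - inner w v.
Proof. by rewrite innerC innerBl !(innerC w). Qed.

Lemma inner0r w : inner w 0 = 0.
Proof. by rewrite innerC inner0l. Qed.

Lemma inner_suml (I : finType) (F : I -> V) w :
  inner (\sum_i F i) w = \sum_i inner (F i) w.
Proof.
by apply: (big_morph (fun u => inner u w)) => [u v|];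
  rewrite ?innerDl ?inner0l.
Qed.

Lemma normDsqr u v : `|u + v| ^+ 2 = `|u| ^+ 2 + 2 * inner u v + `|v| ^+ 2.
Proof. by rewrite -!innerE !innerDl !innerDr (innerC v u); ring. Qed.

Lemma inner_le_norm u v : inner u v <= `|u| * `|v|.
Proof.
have := semi_cauchy_schwarz (@innerC R V) (@innerPl R V) _ u v.
rewrite !innerE !sqrtr_sqr !normr_id; apply=> w.
by rewrite innerE exprn_ge0.
Qed.

Lemma inner_norm_le u v : `|inner u v| <= `|u| * `|v|.
Proof. by rewrite ler_norml lerNl -innerNl -{1}(normrN u) !inner_le_norm. Qed.

(** Take [v := u]. *)
Lemma norm_le_inner u c :
  0 <= c -> (forall v, inner v u <= c * `|v|) -> `|u| <= c.
Proof.
move=> c0 /(_ u); rewrite innerE expr2.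
have [->|u0] := eqVneq u 0; first by rewrite normr0.
by rewrite ler_pM2r // normr_gt0.
Qed.

(** Also the way to check an identity of vectors by scalar computation. *)
Lemma inner_ext u v : (forall w, inner w u = inner w v) -> u = v.
Proof.
move=> uv; apply/subr0_eq/normr0_eq0/eqP; rewrite -sqrf_eq0 -innerE innerBr.
by rewrite uv subrr.
Qed.

End inner_product.

(** * Bounded linear operators *)

Section linear_operators.
Variables (R : realType) (U V : hilbertType R) (A : U -> V).
Hypothesis A_lin : linear A.

Lemma linop0 : A 0 = 0.
Proof. by have := A_lin (-1) 0 0; rewrite scaler0 addr0 scaleN1r addNr. Qed.

Lemma linopD u v : A (u + v) = A u + A v.
Proof. by have := A_lin 1 u v; rewrite !scale1r. Qed.

Lemma linopZ a u : A (a *: u) = a *: A u.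
Proof. by have := A_lin a u 0; rewrite !addr0 linop0 addr0. Qed.

Lemma linopN u : A (- u) = - A u.
Proof. by rewrite -scaleN1r linopZ scaleN1r. Qed.

Lemma linopB u v : A (u - v) = A u - A v.
Proof. by rewrite linopD linopN. Qed.

End linear_operators.

Lemma linear_continuousP (R : realType) (U V : normedModType R) (A : U -> V) :
  linear A -> (continuous A <-> exists2 M, 0 < M &
  forall u, `|A u| <= M * `|u|).
Proof.
move=> A_lin.
pose f : {linear U -> V} := HB.pack A (GRing.isLinear.Build _ _ _ _ A A_lin).
split=> [/(linear_bounded_continuous f)/linear_boundedP Af|[M M0 AM]].
  have [M M0 AM] := pinfty_ex_gt0 Af.
  by exists M.
apply: (bounded_linear_continuous (f := f)).
apply/linear_boundedP; near=> r => x.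
apply: le_trans (AM x) _; exact: ler_wpM2r.
Unshelve. all: by end_near. Qed.

Section bounded_operators.
Variables (R : realType) (U V W : hilbertType R).

Lemma bounded_op_norm (A : U -> V) :
  bounded_op A -> exists2 M, 0 < M & forall u, `|A u| <= M * `|u|.
Proof. by case=> A_lin /(linear_continuousP A_lin). Qed.

Lemma bounded_op_comp (A : U -> V) (B : V -> W) :
  bounded_op A -> bounded_op B -> bounded_op (fun u => B (A u)).
Proof.
move=> [Al Ac] [Bl Bc]; split; first by move=> a u v; rewrite Al Bl.
by move=> u; apply: continuous_comp; [exact: Ac|exact: Bc].
Qed.

Lemma bounded_opD (A B : U -> V) :
  bounded_op A -> bounded_op B -> bounded_op (fun u => A u + B u).
Proof.
move=> [Al Ac] [Bl Bc]; split.
  by move=> a u v; rewrite Al Bl scalerDr addrACA.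
by move=> u; apply: cvgD; [exact: Ac|exact: Bc].
Qed.

Lemma bounded_opZ a (A : U -> V) :
  bounded_op A -> bounded_op (fun u => a *: A u).
Proof.
move=> [Al Ac]; split.
  by move=> b u v; rewrite Al scalerDr !scalerA mulrC.
by move=> u; apply: cvgZr; exact: Ac.
Qed.

Lemma bounded_opB (A B : U -> V) :
  bounded_op A -> bounded_op B -> bounded_op (fun u => A u - B u).
Proof.
move=> bA /(bounded_opZ (-1)) bB; have := bounded_opD bA bB.
by congr bounded_op; apply/funext => u; rewrite scaleN1r.
Qed.

Lemma bounded_op_id : bounded_op (fun u : U => u).
Proof. by split=> // u; exact: cvg_id. Qed.

Lemma bounded_op_sum n (A : 'I_n -> U -> V) :
  (forall i, bounded_op (A i)) -> bounded_op (fun u => \sum_i A i u).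
Proof.
elim: n A => [|n IH] A bA.
  split=> [a u v|]; first by rewrite !big_ord0 scaler0 addr0.
  by under eq_fun do rewrite big_ord0; exact: cst_continuous.
under eq_fun do rewrite big_ord_recr /=.
by apply: bounded_opD; [apply: IH => i; exact: bA|exact: bA].
Qed.

Lemma opnorm_ub (A : U -> V) u : bounded_op A -> `|u| <= 1 -> `|A u| <= opnorm A.
Proof.
move=> /bounded_op_norm[M M0 AM] u1; apply: ub_le_sup; last by exists u.
by exists M => _ [v /= v1 <-]; rewrite (le_trans (AM v)) // ger_pMr.
Qed.

Lemma opnorm_ge (A : U -> V) u : bounded_op A -> `|A u| <= opnorm A * `|u|.
Proof.
move=> bA; have [Al _] := bA.
have [->|u0] := eqVneq u 0; first by rewrite linop0 // !normr0 mulr0.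
have nu : 0 < `|u| by rewrite normr_gt0.
rewrite -ler_pdivrMr // mulrC -[X in X * _](@ger0_norm _ `|u|^-1) ?invr_ge0//.
rewrite -normrZ -linopZ //; apply: opnorm_ub => //.
by rewrite normrZ ger0_norm ?invr_ge0 // mulVf ?gt_eqF.
Qed.

Lemma opnorm_ge0 (A : U -> V) : bounded_op A -> 0 <= opnorm A.
Proof.
by move=> bA; rewrite (le_trans (normr_ge0 (A 0))) // opnorm_ub ?normr0.
Qed.

End bounded_operators.

(** The numerical range of a positive operator controls its norm: apply
    Cauchy-Schwarz in the semi-inner product [inner (A u) v] to the vectors [u]
    and [A u]. *)
Lemma symmetric_norm_le (R : realType) (V : hilbertType R) (A : V -> V) c :
  0 <= c -> linear A -> (forall u v, inner (A u) v = inner u (A v)) ->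
  (forall u, 0 <= inner (A u) u) -> (forall u, inner (A u) u <= c * `|u| ^+ 2) ->
  forall u, `|A u| <= c * `|u|.
Proof.
move=> c0 Al As A0 Ac u.
have Am := semi_cauchy_schwarz (b := fun u v => inner (A u) v) _ _ A0 u (A u).
have /Am{}Am : forall u v, inner (A u) v = inner (A v) u.
  by move=> v w; rewrite As innerC.
have {}Am : inner (A u) (A u) <=
    Num.sqrt (inner (A u) u) * Num.sqrt (inner (A (A u)) (A u)).
  by apply: Am => a v w z; rewrite Al innerPl.
have {Am} : `|A u| ^+ 2 <= (c * `|u|) * `|A u|.
  rewrite -innerE (le_trans Am) // -sqrtrM //.
  rewrite -[leRHS]ger0_norm ?mulr_ge0// -sqrtr_sqr; apply: ler_wsqrtr.
  have -> : (c * `|u| * `|A u|) ^+ 2 = (c * `|u|^+2) * (c * `|A u|^+2) by ring.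
  exact: ler_pM.
have [->|Au0] := eqVneq (A u) 0; first by rewrite normr0 mulr_ge0.
by rewrite expr2 ler_pM2r // normr_gt0.
Qed.

(** * Square roots of positive operators *)

(** Here [A] is a symmetric contraction. The limit [L] of the iteration
    [B_(n+1) = (A + B_n^2) / 2] from [B_0 = 0] satisfies [L^2 = 2 L - A], that
    is, [1 - L] is a square root of [1 - A]. *)
Section square_root.
Variables (R : realType) (V : hilbertType R) (A : V -> V).
Hypotheses (A_lin : linear A) (A_le1 : forall u, `|A u| <= `|u|).
Hypothesis A_sym : forall u v, inner (A u) v = inner u (A v).

Fixpoint sqrt_iter n (u : V) : V :=
  if n is n'.+1 then 2^-1 *: (A u + sqrt_iter n' (sqrt_iter n' u)) else 0.

(** The same iteration run on the scalar 1. It dominates the operator iteration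
    in norm, and so do its increments; as it is increasing and bounded by 1, the
    operators form a Cauchy sequence in norm. *)
Fixpoint sqrt_rate n : R := if n is n'.+1 then (1 + sqrt_rate n' ^+ 2) / 2 else 0.

Lemma sqrt_rate_itv n : 0 <= sqrt_rate n <= 1.
Proof.
elim: n => [|n /andP[b0 b1]] /=; first by rewrite lexx ler01.
by apply/andP; split; nra.
Qed.

Lemma sqrt_rate_nondecreasing : nondecreasing_seq sqrt_rate.
Proof.
apply/nondecreasing_seqP => n /=.
by have := sqr_ge0 (sqrt_rate n - 1); rewrite sqrrB; nra.
Qed.

Lemma sqrt_iter_linear n : linear (sqrt_iter n).
Proof.
elim: n => [|n IH] a u v /=; first by rewrite scaler0 addr0.
by rewrite A_lin !IH addrACA scalerDr -(scalerDr a) !scalerA mulrC.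
Qed.

Lemma sqrt_iter_sym n u v : inner (sqrt_iter n u) v = inner u (sqrt_iter n v).
Proof.
elim: n u v => [|n IH] u v /=; first by rewrite inner0l inner0r.
by rewrite innerZl innerZr innerDl innerDr A_sym !IH.
Qed.

Lemma sqrt_iter_norm n u : `|sqrt_iter n u| <= sqrt_rate n * `|u|.
Proof.
elim: n u => [|n IH] u /=; first by rewrite normr0 mul0r.
have /andP[b0 b1] := sqrt_rate_itv n.
rewrite normrZ ger0_norm ?invr_ge0//.
have h1 := le_trans (IH (sqrt_iter n u)) (ler_wpM2l b0 (IH u)).
have h2 := ler_normD (A u) (sqrt_iter n (sqrt_iter n u)).
by have := A_le1 u; lra.
Qed.

(** With [B' = B_n] and [B = B_(n+1)], the next step is half of
    [B^2 - B'^2 = B (B - B') + (B - B') B'], of norm at most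
    [(b + b') (b - b') = b^2 - b'^2]. *)
Lemma sqrt_iter_step n u :
  `|sqrt_iter n.+1 u - sqrt_iter n u| <= (sqrt_rate n.+1 - sqrt_rate n) * `|u|.
Proof.
elim: n u => [|n IH] u.
  rewrite /= !addr0 !subr0 expr0n addr0 normrZ ger0_norm ?invr_ge0//.
  by have := A_le1 u; lra.
set B := sqrt_iter n.+1; set B' := sqrt_iter n.
have B_lin : linear B := @sqrt_iter_linear n.+1.
have -> : sqrt_iter n.+2 u - B u =
    2^-1 *: (B (B u - B' u) + (B (B' u) - B' (B' u))).
  rewrite (linopB B_lin) addrA subrK.
  rewrite -[X in _ - X]/(2^-1 *: (A u + B' (B' u))) -scalerBr opprD addrACA.
  by rewrite subrr add0r.
rewrite normrZ ger0_norm ?invr_ge0//.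
have /andP[b0 b1] := sqrt_rate_itv n.
have /andP[c0 c1] := sqrt_rate_itv n.+1.
have bc := sqrt_rate_nondecreasing (leqnSn n).
have h0 := ler_normD (B (B u - B' u)) (B (B' u) - B' (B' u)).
have h1 := le_trans (sqrt_iter_norm n.+1 _) (ler_wpM2l c0 (IH u)).
have h2 : `|B (B' u) - B' (B' u)| <=
    (sqrt_rate n.+1 - sqrt_rate n) * (sqrt_rate n * `|u|).
  apply: le_trans (IH _) _; apply: ler_wpM2l (sqrt_iter_norm _ _).
  by rewrite subr_ge0.
have -> : sqrt_rate n.+2 - sqrt_rate n.+1 =
   (1 + sqrt_rate n.+1 ^+ 2) / 2 - (1 + sqrt_rate n ^+ 2) / 2 by [].
move: h0 h1 h2; rewrite -/B -/B'; move: (sqrt_rate n.+1) (sqrt_rate n) => c b.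
lra.
Qed.

Lemma sqrt_iter_dist n k u :
  `|sqrt_iter (n + k) u - sqrt_iter n u| <= (sqrt_rate (n + k) - sqrt_rate n) * `|u|.
Proof.
elim: k => [|k IH]; first by rewrite addn0 !subrr normr0 mul0r.
rewrite addnS.
have := ler_normD (sqrt_iter (n + k).+1 u - sqrt_iter (n + k) u)
  (sqrt_iter (n + k) u - sqrt_iter n u).
by rewrite addrA subrK; have := sqrt_iter_step (n + k) u; lra.
Qed.

Lemma sqrt_rate_cvg : cvgn sqrt_rate.
Proof.
apply: nondecreasing_is_cvgn; first exact: sqrt_rate_nondecreasing.
by exists 1 => _ [n _ <-]; have /andP[] := sqrt_rate_itv n.
Qed.

(** The distance of the scalar iteration to its limit; identities pass to the limit by
    bounding their defect by a fixed multiple of every [gap n]. *)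
Let gap n := limn sqrt_rate - sqrt_rate n.

Let gap_ge n k : sqrt_rate (n + k) - sqrt_rate n <= gap n.
Proof.
by rewrite lerB // nondecreasing_cvgn_le //;
  [exact: sqrt_rate_nondecreasing|exact: sqrt_rate_cvg].
Qed.

Let gap_ge0 n : 0 <= gap n.
Proof. by rewrite (le_trans _ (gap_ge n 0)) // addn0 subrr. Qed.

Let gap_le0 x c : (forall n, x <= gap n * c) -> x <= 0.
Proof.
move=> xc; have gap_cvg : gap n * c @[n --> \oo] --> (0 : R).
  rewrite -(mul0r c); apply: cvgMl; rewrite -[X in _ --> X](subrr (limn sqrt_rate)).
  by apply: cvgB; [exact: cvg_cst|exact: sqrt_rate_cvg].
by apply: cvgr_to_ge gap_cvg _; exact: nearW.
Qed.

Let gap_eq0 (z : V) c : (forall n, `|z| <= gap n * c) -> z = 0.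
Proof. by move=> /gap_le0; rewrite normr_le0 => /eqP. Qed.

Definition sqrt_lim (u : V) : V := limn (sqrt_iter ^~ u).

Lemma sqrt_lim_cvg u : sqrt_iter n u @[n --> \oo] --> sqrt_lim u.
Proof.
apply/cauchy_cvgP/cauchyP => e e0.
have [n gap_e] : exists n, gap n * `|u| < e.
  apply/not_existsP => h; have /gap_le0 : forall n, e <= gap n * `|u|.
    by move=> n; rewrite leNgt; apply/negP/h.
  by rewrite leNgt e0.
exists (sqrt_iter n u).
suff : \forall k \near \oo, ball (sqrt_iter n u) e (sqrt_iter k u) by [].
near=> k.
have nk : (n <= k)%N by near: k; exact: nbhs_infty_ge.
rewrite -ball_normE /= distrC -(subnKC nk).
rewrite (le_lt_trans (sqrt_iter_dist _ _ _)) // (le_lt_trans _ gap_e) //.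
by rewrite ler_wpM2r.
Unshelve. all: by end_near. Qed.

Let sqrt_lim_dist n u : `|sqrt_lim u - sqrt_iter n u| <= gap n * `|u|.
Proof.
have : `|sqrt_iter k u - sqrt_iter n u| @[k --> \oo] --> `|sqrt_lim u - sqrt_iter n u|.
  by apply: cvg_norm; apply: cvgB; [exact: sqrt_lim_cvg|exact: cvg_cst].
move=> /cvgr_to_le; apply; near=> k.
have nk : (n <= k)%N by near: k; exact: nbhs_infty_ge.
rewrite -(subnKC nk) (le_trans (sqrt_iter_dist _ _ _)) //.
by rewrite ler_wpM2r.
Unshelve. all: by end_near. Qed.

Lemma sqrt_lim_norm u : `|sqrt_lim u| <= `|u|.
Proof.
have := @sqrt_lim_cvg u => /cvg_norm/cvgr_to_le; apply; apply: nearW => n.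
rewrite (le_trans (sqrt_iter_norm _ _)) // ler_piMl //.
by have /andP[] := sqrt_rate_itv n.
Qed.

Lemma sqrt_lim_linear : linear sqrt_lim.
Proof.
move=> a u v; apply/subr0_eq/(@gap_eq0 _ (`|a *: u + v| + (`|a| * `|u| + `|v|))) => n.
have -> : sqrt_lim (a *: u + v) - (a *: sqrt_lim u + sqrt_lim v) =
    (sqrt_lim (a *: u + v) - sqrt_iter n (a *: u + v)) -
    (a *: (sqrt_lim u - sqrt_iter n u) + (sqrt_lim v - sqrt_iter n v)).
  rewrite (sqrt_iter_linear n a) scalerBr [X in _ = _ - X]addrACA -opprD opprB.
  by rewrite addrA subrK.
apply: le_trans (ler_normB _ _) _; rewrite mulrDr lerD//.
apply: le_trans (ler_normD _ _) _; rewrite mulrDr lerD// normrZ mulrCA.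
by rewrite ler_wpM2l.
Qed.

Lemma sqrt_lim_sym u v : inner (sqrt_lim u) v = inner u (sqrt_lim v).
Proof.
apply/subr0_eq/normr0_eq0/eqP; rewrite -normr_le0 normr_id.
apply: (@gap_le0 _ (2 * (`|u| * `|v|))) => n.
have -> : inner (sqrt_lim u) v - inner u (sqrt_lim v) =
    inner (sqrt_lim u - sqrt_iter n u) v - inner u (sqrt_lim v - sqrt_iter n v).
  by rewrite innerBl innerBr sqrt_iter_sym; ring.
have h1 := le_trans (inner_norm_le _ _) (ler_wpM2r (normr_ge0 v) (sqrt_lim_dist n u)).
have h2 := le_trans (inner_norm_le _ _) (ler_wpM2l (normr_ge0 u) (sqrt_lim_dist n v)).
by apply: le_trans (ler_normB _ _) _; lra.
Qed.

(** Both [L^2 - B_n^2] and [L - B_(n+1)] are controlled by [gap n], and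
    [2 B_(n+1) - A = B_n^2] by definition. *)
Lemma sqrt_lim_fixed u : sqrt_lim (sqrt_lim u) = 2 *: sqrt_lim u - A u.
Proof.
set L := sqrt_lim; apply/subr0_eq/(@gap_eq0 _ (4 * `|u|)) => n.
set B := sqrt_iter n; have B_lin : linear B := @sqrt_iter_linear n.
have /andP[b0 b1] := sqrt_rate_itv n.
have -> : L (L u) - (2 *: L u - A u) =
    ((L (L u) - B (L u)) + B (L u - B u)) - 2 *: (L u - sqrt_iter n.+1 u).
  rewrite (linopB B_lin) [sqrt_iter n.+1 u]/= -/B.
  by apply: inner_ext => w; rewrite !(innerDr, innerNr, innerZr); field.
have h1 := le_trans (sqrt_lim_dist n (L u)) (ler_wpM2l (gap_ge0 n) (sqrt_lim_norm u)).
have h2 : `|B (L u - B u)| <= gap n * `|u|.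
  by rewrite (le_trans (sqrt_iter_norm _ _)) // (le_trans _ (sqrt_lim_dist n u)) // ler_piMl.
have h3 : `|2 *: (L u - sqrt_iter n.+1 u)| <= 2 * (gap n * `|u|).
  rewrite normrZ ger0_norm // ler_wpM2l //.
  rewrite (le_trans (sqrt_lim_dist n.+1 u)) // ler_wpM2r // lerB //.
  exact: sqrt_rate_nondecreasing.
have h4 := ler_normD (L (L u) - B (L u)) (B (L u - B u)).
apply: le_trans (ler_normB _ _) _; rewrite -/L -/B in h1 *; lra.
Qed.

End square_root.

(** Dividing by a norm bound [M] makes [A = 1 - P / M] a symmetric contraction,
    and [sqrt M (1 - L)] squares to [M (1 - A) = P]. *)
Lemma positive_op_sqrt (R : realType) (V : hilbertType R) (P : V -> V) :
  positive_op P -> exists2 B, positive_op B & forall v, B (B v) = P v.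
Proof.
move=> [bP P_sym P0]; have [M M0 PM] := bounded_op_norm bP; have [P_lin _] := bP.
pose A u := u - M^-1 *: P u.
have bA : bounded_op A by apply: bounded_opB; [exact: bounded_op_id|exact: bounded_opZ].
have A_lin : linear A by case: bA.
have A_sym u v : inner (A u) v = inner u (A v).
  by rewrite innerBl innerBr innerZl innerZr P_sym.
have A_quad u : inner (A u) u = `|u| ^+ 2 - M^-1 * inner (P u) u.
  by rewrite innerBl innerZl innerE.
have A_le1 u : `|A u| <= `|u|.
  rewrite -[leRHS]mul1r; apply: symmetric_norm_le => // {}u; rewrite A_quad.
    rewrite subr_ge0 mulrC ler_pdivrMr // (le_trans (inner_le_norm _ _)) //.
    by have := ler_wpM2r (normr_ge0 u) (PM u); rewrite expr2; lra.
  by rewrite mul1r lerBlDr lerDl mulr_ge0 // invr_ge0 ltW.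
have L_lin := sqrt_lim_linear A_lin A_le1; have L_sym := sqrt_lim_sym A_lin A_le1 A_sym.
have L_norm := sqrt_lim_norm A_lin A_le1; have LL := sqrt_lim_fixed A_lin A_le1.
move: (sqrt_lim A) => L in L_lin L_sym L_norm LL.
have bL : bounded_op L.
  by split=> //; apply/linear_continuousP => //; exists 1 => // u; rewrite mul1r.
have bB : bounded_op (fun u => Num.sqrt M *: (u - L u)).
  by apply: bounded_opZ; apply: bounded_opB => //; exact: bounded_op_id.
exists (fun u => Num.sqrt M *: (u - L u)).
  split=> // [u v|u]; first by rewrite innerZl innerZr innerBl innerBr L_sym.
  rewrite innerZl mulr_ge0 ?sqrtr_ge0 // innerBl innerE subr_ge0.
  by rewrite (le_trans (inner_le_norm _ _)) // expr2 ler_wpM2r.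
move=> u; rewrite (linopZ L_lin) -scalerBr scalerA -expr2 sqr_sqrtr ?ltW //.
rewrite (linopB L_lin) LL /A.
have -> : u - L u - (L u - (2 *: L u - (u - M^-1 *: P u))) = M^-1 *: P u.
  by apply: inner_ext => w; rewrite !(innerDr, innerNr, innerZr); ring.
by rewrite scalerA mulfV ?scale1r // gt_eqF.
Qed.

(** * Invertibility of shifted positive operators *)

Lemma invertible_op_of_ge (R : realType) (U V : hilbertType R) (A : U -> V) c :
  0 < c -> linear A -> (forall u, c * `|u| <= `|A u|) ->
  (forall v, exists u, A u = v) -> invertible_op A.
Proof.
move=> c0 A_lin Ac /choice[B AB].
have BA : cancel A B.
  move=> u; apply/subr0_eq/normr0_eq0/eqP; rewrite -normr_le0 normr_id.
  by rewrite -(pmulr_rle0 _ c0) (le_trans (Ac _)) // (linopB A_lin) AB subrr normr0.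
exists B; split=> //.
have B_lin : linear B by move=> a u v; rewrite -{1}(AB u) -{1}(AB v) -A_lin BA.
split=> //; apply/linear_continuousP => //; exists c^-1; rewrite ?invr_gt0 // => v.
by rewrite ler_pdivlMl // -{2}(AB v).
Qed.

(** The shifted operator [A] is bounded below by [lambda]. With [M] a norm bound
    of [K], the operator [G = 1 - A / (M + lambda)] is positive with norm at most
    [M / (M + lambda) < 1], so that [A z = w], which is
    [z = G z + w / (M + lambda)], is solved by Banach's fixed point theorem. *)
Lemma positive_op_shift_invertible (R : realType) (V : hilbertType R)
    (K : V -> V) (lambda : R) :
  positive_op K -> 0 < lambda -> invertible_op (fun z => K z + lambda *: z).
Proof.
move=> [bK K_sym K0] l0; have [M M0 KM] := bounded_op_norm bK.
pose A z := K z + lambda *: z; rewrite -/A.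
have bA : bounded_op A.
  by apply: bounded_opD => //; apply: bounded_opZ; exact: bounded_op_id.
have A_lin : linear A by case: bA.
have A_sym u v : inner (A u) v = inner u (A v).
  by rewrite innerDl innerDr innerZl innerZr K_sym.
have A_quad u : inner (A u) u = inner (K u) u + lambda * `|u| ^+ 2.
  by rewrite innerDl innerZl innerE.
have cM : 0 < M + lambda by rewrite addr_gt0.
apply: (@invertible_op_of_ge _ _ _ _ lambda) => // [u|w].
  have [->|u0] := eqVneq u 0; first by rewrite normr0 mulr0.
  rewrite -(@ler_pM2r _ `|u|) ?normr_gt0 // -mulrA -expr2.
  by rewrite (le_trans _ (inner_le_norm _ _)) // A_quad lerDr.
pose G u := u - (M + lambda)^-1 *: A u.
have bG : bounded_op G by apply: bounded_opB; [exact: bounded_op_id|exact: bounded_opZ].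
have [G_lin _] := bG.
pose q := M / (M + lambda).
have q0 : 0 <= q by rewrite divr_ge0 // ltW.
have G_norm u : `|G u| <= q * `|u|.
  apply: symmetric_norm_le => // {u}[u v|u|u].
  - by rewrite innerBl innerBr innerZl innerZr A_sym.
  - rewrite innerBl innerZl innerE A_quad subr_ge0 mulrC ler_pdivrMr //.
    rewrite mulrDr [lambda * _]mulrC lerD2r (le_trans (inner_le_norm _ _)) //.
    by have := ler_wpM2r (normr_ge0 u) (KM u); rewrite expr2; lra.
  - rewrite innerBl innerZl innerE A_quad.
    have -> : q * `|u| ^+ 2 = `|u| ^+ 2 - (M + lambda)^-1 * (lambda * `|u| ^+ 2).
      by rewrite /q; field; rewrite gt_eqF.
    by rewrite lerB // ler_wpM2l ?invr_ge0 ?(ltW cM) // lerDr.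
pose F z := G z + (M + lambda)^-1 *: w.
have FB u v : F u - F v = G (u - v).
  by rewrite (linopB G_lin) /F opprD addrACA subrr addr0.
have F_homo : {homo F : z / [set: V] z >-> [set: V] z} by [].
have F_contr : is_contraction (mkfun F_homo).
  exists (NngNum q0); split; first by rewrite /= ltr_pdivrMr // mul1r ltrDl.
  by move=> [u v] _ /=; rewrite FB G_norm.
have [z _ zF] := banach_fixed_point F_contr closedT (ex_intro _ 0 I).
exists z; apply/subr0_eq.
have : (M + lambda)^-1 *: (A z - w) = z - F z.
  by rewrite /F /G scalerBr opprD opprB addrA subrKC.
rewrite -[F z]zF subrr => /eqP.
by rewrite scaler_eq0 invr_eq0 gt_eqF //= => /eqP.
Qed.

(** * Chosen inverses and square roots *)

Lemma inv_opP (R : realType) (U V : hilbertType R) (A : U -> V) :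
  invertible_op A -> is_inverse_op A (inv_op A).
Proof. by move=> A_inv; apply: (@getPex _ [set B | is_inverse_op A B]). Qed.

Lemma inverse_op_positive (R : realType) (V : hilbertType R) (A B : V -> V) :
  positive_op A -> is_inverse_op A B -> positive_op B.
Proof.
move=> [_ A_sym A0] [bB AB BA]; split=> // [u v|u].
  by rewrite -{1}(BA v) -A_sym BA.
by rewrite -{2}(BA u) innerC.
Qed.

Lemma sqrt_opP (R : realType) (V : hilbertType R) (P : V -> V) :
  positive_op P -> positive_op (sqrt_op P) /\ forall v, sqrt_op P (sqrt_op P v) = P v.
Proof.
move=> /positive_op_sqrt[B B_pos BB].
exact: (@getPex _ [set B | positive_op B /\ forall v, B (B v) = P v]
  (ex_intro _ B (conj B_pos BB))).
Qed.

Lemma sqrt_op_normE (R : realType) (V : hilbertType R) (P : V -> V) v :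
  positive_op P -> `|sqrt_op P v| ^+ 2 = inner (P v) v.
Proof. by move=> /sqrt_opP[[_ B_sym _] BB]; rewrite -innerE -B_sym BB. Qed.

(** * Hilbert sums and bounded noise *)

Lemma normE_hsum (R : realType) (Y : hilbertType R) m (z : hilbert_sum Y m) :
  `|z| ^+ 2 = \sum_i `|z i| ^+ 2.
Proof. by rewrite -innerE; apply: eq_bigr => i _; rewrite innerE. Qed.

Lemma noise_set_norm (R : realType) (Y : hilbertType R) m dbar (eta : hilbert_sum Y m) :
  noise_set dbar eta -> `|eta| <= Num.sqrt (m%:R * dbar ^+ 2).
Proof.
move=> eta_le; rewrite -[leLHS]ger0_norm // -sqrtr_sqr ler_wsqrtr // normE_hsum.
rewrite mulr_natl -[m in leRHS]card_ord -sumr_const; apply: ler_sum => i _.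
by apply: lerXn2r; rewrite ?nnegrE // (le_trans _ (eta_le i)).
Qed.

(** * Sampling and its adjoint *)

Section sampling.
Variables (R : realType) (T : Type) (Y H : hilbertType R) (E : rkhs T Y H).
Variables (Phi : T -> Y -> H) (Phi_feature : feature_map E Phi).
Variables (m : nat) (X : 'I_m -> T).
Local Notation K := (kernel_of E Phi).

Definition sample (s : H) : hilbert_sum Y m := [ffun i => E s (X i)].

Definition combine (z : hilbert_sum Y m) : H := \sum_i Phi (X i) (z i).

Lemma feature_bounded x : bounded_op (Phi x).
Proof. by have [] := Phi_feature x. Qed.

Lemma featureE x v s : inner (Phi x v) s = inner v (E s x).
Proof. by have [_ ->] := Phi_feature x. Qed.

Lemma eval_bounded x : bounded_op (fun s => E s x).
Proof.
have E_lin : linear (fun s => E s x) by move=> a s t; exact: eval_linear.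
split=> //; apply/linear_continuousP => //.
have [M M0 PM] := bounded_op_norm (feature_bounded x).
exists M => // s; apply: norm_le_inner => [|v]; first by rewrite mulr_ge0 // ltW.
rewrite -featureE (le_trans (inner_le_norm _ _)) // mulrAC.
by rewrite ler_wpM2r.
Qed.

Lemma sample_adjoint z s : inner (combine z) s = inner z (sample s).
Proof.
rewrite inner_suml; apply: eq_bigr => i _.
by rewrite featureE ffunE.
Qed.

Lemma combine_bounded : bounded_op combine.
Proof.
apply: bounded_op_sum => i; apply: bounded_op_comp (feature_bounded (X i)).
have p_lin : linear (fun z : hilbert_sum Y m => z i).
  by move=> a z w; rewrite !ffunE.
split=> //; apply/linear_continuousP => //; exists 1 => // z.
by rewrite mul1r; exact: hsum_norm_ge.
Qed.

Lemma sample_bounded : bounded_op sample.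
Proof.
have S_lin : linear sample by move=> a s t; apply/ffunP => i; rewrite !ffunE eval_linear.
split=> //; apply/linear_continuousP => //.
have [M M0 CM] := bounded_op_norm combine_bounded.
exists M => // s; apply: norm_le_inner => [|z]; first by rewrite mulr_ge0 // ltW.
rewrite -sample_adjoint (le_trans (inner_le_norm _ _)) // mulrAC.
by rewrite ler_wpM2r.
Qed.

Lemma eval_combine x z : E (combine z) x = KxX K X x z.
Proof.
have [E_lin _] := eval_bounded x.
exact: (big_morph (fun s => E s x) (linopD E_lin) (linop0 E_lin)).
Qed.

Lemma sample_combine z : sample (combine z) = KXX K X z.
Proof. by apply/ffunP => i; rewrite !ffunE eval_combine. Qed.

Lemma sample_feature x v : sample (Phi x v) = KXx K X x v.
Proof. by apply/ffunP => i; rewrite !ffunE. Qed.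

Lemma KXX_positive : positive_op (KXX K X).
Proof.
have -> : KXX K X = fun z => sample (combine z).
  by apply/funext => z; rewrite sample_combine.
split=> [|z w|z].
- exact: bounded_op_comp combine_bounded sample_bounded.
- by rewrite innerC -!sample_adjoint innerC.
- by rewrite innerC -sample_adjoint innerE exprn_ge0.
Qed.

Lemma KxX_bounded x : bounded_op (KxX K X x).
Proof.
have := bounded_op_comp combine_bounded (eval_bounded x).
by congr bounded_op; apply/funext => z; rewrite eval_combine.
Qed.

(** * Kernel ridge regression *)

Lemma krr_costE lambda y s :
  krr_cost E X lambda y s = `|sample s - y| ^+ 2 + lambda * `|s| ^+ 2.
Proof. by rewrite normE_hsum; congr (_ + _); apply: eq_bigr => i _; rewrite !ffunE. Qed.

(** Along the line [s + t h] the cost grows by [2 t b + t^2 c], with [b] the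
    left-hand side below; a nonnegative such polynomial has [b = 0]. *)
Lemma krr_stationary lambda y s h : 0 < lambda -> is_krr_solution E X lambda y s ->
  inner (sample s - y) (sample h) + lambda * inner s h = 0.
Proof.
move=> l0 s_min; set b := LHS.
have [S_lin _] := sample_bounded.
set c := `|sample h| ^+ 2 + lambda * `|h| ^+ 2.
have c0 : 0 <= c by rewrite addr_ge0 ?mulr_ge0 ?exprn_ge0 // ltW.
have cost_t t : 0 <= 2 * t * b + t ^+ 2 * c.
  have := s_min (s + t *: h); rewrite !krr_costE.
  rewrite (linopD S_lin) (linopZ S_lin) addrAC !normDsqr !innerZr !normrZ !exprMn.
  by rewrite !real_normK ?num_real // /b /c; lra.
have c1 : c + 1 != 0 by rewrite gt_eqF // ltr_wpDl.
(* The minimum is at [- b / c]; adding 1 also covers [c = 0]. *)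
have := cost_t (- b / (c + 1)).
have -> : 2 * (- b / (c + 1)) * b + (- b / (c + 1)) ^+ 2 * c =
    - ((b / (c + 1)) ^+ 2 * (c + 2)) by field.
rewrite oppr_ge0 pmulr_lle0 ?ltr_wpDl // => b0.
have : (b / (c + 1)) ^+ 2 == 0 by rewrite eq_le b0 sqr_ge0.
by rewrite sqrf_eq0 mulf_eq0 invr_eq0 (negPf c1) orbF => /eqP.
Qed.

(** Stationarity says [s = combine w] with [lambda w = y - sample s]; sampling
    gives [KXX w + lambda w = y]. *)
Lemma krr_solutionE lambda y s : 0 < lambda -> is_krr_solution E X lambda y s ->
  s = combine (inv_op (fun z => KXX K X z + lambda *: z) y).
Proof.
move=> l0 s_min.
have [_ reg_inv _] := inv_opP (positive_op_shift_invertible KXX_positive l0).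
pose w := lambda^-1 *: (y - sample s).
have s_w : s = combine w.
  apply: inner_ext => h; rewrite [RHS]innerC sample_adjoint innerZl.
  have := krr_stationary h l0 s_min; rewrite -opprB innerNl (innerC s) => st.
  apply: (mulfI (lt0r_neq0 l0)); rewrite mulrA mulfV ?mul1r ?lt0r_neq0 //.
  by move: st => /eqP; rewrite addrC subr_eq0 => /eqP.
rewrite {1}s_w; congr combine; rewrite -{1}(reg_inv w); congr inv_op.
by rewrite -sample_combine -s_w scalerA mulfV ?gt_eqF // scale1r subrKC.
Qed.

(** * Interpolation residuals and the power operator *)

Hypothesis K_inv : invertible_op (KXX K X).
Local Notation Kinv := (inv_op (KXX K X)).

Let KinvK z : KXX K X (Kinv z) = z.
Proof. by have [_ _] := inv_opP K_inv. Qed.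

Let Kinv_bounded : bounded_op Kinv.
Proof. by have [] := inv_opP K_inv. Qed.

(** The orthogonal projection onto the kernel of [sample]. *)
Definition residual (s : H) : H := s - combine (Kinv (sample s)).

Lemma residual_bounded : bounded_op residual.
Proof.
apply: bounded_opB; first exact: bounded_op_id.
apply: bounded_op_comp combine_bounded.
exact: bounded_op_comp sample_bounded Kinv_bounded.
Qed.

Lemma sample_residual s : sample (residual s) = 0.
Proof.
have [S_lin _] := sample_bounded.
by rewrite (linopB S_lin) sample_combine KinvK subrr.
Qed.

Lemma residual_orthogonal s t : sample t = 0 -> inner (residual s) t = inner s t.
Proof. by move=> t0; rewrite innerBl sample_adjoint t0 inner0r subr0. Qed.

Lemma norm_residual s :
  `|residual s| ^+ 2 = `|s| ^+ 2 - inner (sample s) (Kinv (sample s)).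
Proof.
rewrite -innerE residual_orthogonal ?sample_residual // innerBr innerE.
by rewrite (innerC s) sample_adjoint innerC.
Qed.

(** If [s] interpolates [y], then [residual s] is its difference with
    [combine (KXX^-1 y)], and [|residual s|^2] is the excess of [|s|^2] over the
    squared norm of that interpolant, which minimality makes nonpositive. *)
Lemma min_norm_interpolantE y s :
  is_min_norm_interpolant E X y s -> s = combine (Kinv y).
Proof.
move=> [s_y s_min]; have sy : sample s = y by apply/ffunP => i; rewrite ffunE s_y.
apply/subr0_eq; rewrite -[X in Kinv X]sy -/(residual s).
have /s_min s_le : interpolates E X y (combine (Kinv y)).
  move=> i; have := sample_combine (Kinv y).
  by rewrite KinvK => /ffunP/(_ i); rewrite ffunE.
have res_le0 : `|residual s| ^+ 2 <= 0.
  rewrite norm_residual sy subr_le0 (innerC y) -[X in inner _ X](KinvK y).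
  by rewrite -sample_combine -sample_adjoint innerE lerXn2r ?nnegrE.
by apply/normr0_eq0/eqP; rewrite -sqrf_eq0 eq_le res_le0 sqr_ge0.
Qed.

Lemma power_opE x v : power_op K X x v = E (residual (Phi x v)) x.
Proof.
have [E_lin _] := eval_bounded x.
by rewrite (linopB E_lin) eval_combine sample_feature.
Qed.

(** The power operator at [x] is the Gram operator of the features at [x]
    projected onto the kernel of [sample]. *)
Lemma inner_power_op x u v :
  inner (power_op K X x u) v = inner (residual (Phi x u)) (residual (Phi x v)).
Proof.
rewrite [RHS]innerC residual_orthogonal ?sample_residual //.
by rewrite featureE power_opE innerC.
Qed.

Lemma power_op_positive x : positive_op (power_op K X x).
Proof.
split=> [|u v|u]; last by rewrite inner_power_op innerE exprn_ge0.
  rewrite (funext (power_opE x)).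
  exact: bounded_op_comp (bounded_op_comp (feature_bounded x) residual_bounded)
    (eval_bounded x).
by rewrite inner_power_op [RHS]innerC inner_power_op innerC.
Qed.

(** Since [g] lies in the kernel of [sample], only the projection of [Phi x v]
    contributes to [<v, g x> = <Phi x v, g>], and the norm of that projection is
    [|P^(1/2) v|]. *)
Lemma eval_le_power x g : sample g = 0 ->
  `|E g x| <= opnorm (sqrt_op (power_op K X x)) * `|g|.
Proof.
move=> g0; have P_pos := power_op_positive x.
have [[bB _ _] _] := sqrt_opP P_pos.
apply: norm_le_inner => [|v]; first by rewrite mulr_ge0 // opnorm_ge0.
rewrite -featureE -residual_orthogonal // (le_trans (inner_le_norm _ _)) //.
rewrite mulrAC ler_wpM2r // (le_trans _ (opnorm_ge v bB)) //.
by rewrite -(@ler_pXn2r _ 2) ?nnegrE // sqrt_op_normE // inner_power_op innerE.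
Qed.

(** * Worst-case noise *)

(** Positivity of [KXX^-1] and Cauchy-Schwarz bound the objective, so that the
    real supremum is a genuine upper bound. *)
Lemma Delta_ge dbar y (eta : hilbert_sum Y m) : noise_set dbar eta ->
  2 * inner eta (Kinv y) - inner eta (Kinv eta) <= Delta K X dbar y.
Proof.
move=> eta_le; apply: ub_le_sup; last by exists eta.
exists (2 * (Num.sqrt (m%:R * dbar ^+ 2) * `|Kinv y|)) => _ [z /noise_set_norm z_le <-].
have [_ _ Kinv0] := inverse_op_positive KXX_positive (inv_opP K_inv).
have h1 := le_trans (inner_le_norm z (Kinv y)) (ler_wpM2r (normr_ge0 _) z_le).
by have := Kinv0 z; rewrite innerC; lra.
Qed.

Lemma Nabla_ge dbar x (eta : hilbert_sum Y m) : noise_set dbar eta ->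
  `|KxX K X x (Kinv eta)| <= Nabla K X dbar x.
Proof.
move=> eta_le; apply: ub_le_sup; last by exists eta.
have [M M0 KM] := bounded_op_norm (bounded_op_comp Kinv_bounded (KxX_bounded x)).
exists (M * Num.sqrt (m%:R * dbar ^+ 2)) => _ [z /noise_set_norm z_le <-].
by rewrite (le_trans (KM z)) // ler_wpM2l // ltW.
Qed.

(** With [d = y - sample f], the energy [|f|^2 - <y - d, KXX^-1 (y - d)>] of the
    residual expands into
    [|f|^2 - <y, KXX^-1 y> + 2 <d, KXX^-1 y> - <d, KXX^-1 d>]. *)
Lemma residual_energy f Gamma dbar y :
  `|f| <= Gamma -> noise_set dbar (y - sample f) ->
  `|residual f| ^+ 2 <= Gamma ^+ 2 + Delta K X dbar y - `|combine (Kinv y)| ^+ 2.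
Proof.
move=> f_le noise; have Del := Delta_ge y noise.
have [[Kinv_lin _] Kinv_sym _] := inverse_op_positive KXX_positive (inv_opP K_inv).
have f2 : `|f| ^+ 2 <= Gamma ^+ 2.
  by apply: lerXn2r; rewrite ?nnegrE // (le_trans _ f_le).
rewrite norm_residual -(innerE (combine _)) sample_adjoint sample_combine KinvK.
move: Del; rewrite !(linopB Kinv_lin) !(innerBl, innerBr).
rewrite -(Kinv_sym y (sample f)) -(Kinv_sym y y) (innerC (sample f) (Kinv y)); lra.
Qed.

End sampling.

(** * The error bound *)

Theorem theorem1 (R : realType) (T : Type) (Y H : hilbertType R)
    (E : rkhs T Y H) (Phi : T -> Y -> H) (Phi_feature : feature_map E Phi)
    (K : T -> T -> Y -> Y) (K_def : K = kernel_of E Phi)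
    (K_bounded : bounded_kernel K)
    (H_normal : forall x y, Phi x y = 0 -> y = 0)
    (KXX_invertible : forall (n : nat) (Z : 'I_n -> T),
      injective Z -> invertible_op (KXX K Z))
    (f : H) (Gamma : R) (f_bound : `|f| <= Gamma)
    (m : nat) (X : 'I_m -> T) (X_inj : injective X)
    (dbar : R) (delta : hilbert_sum Y m)
    (delta_bound : forall i, `|delta i| <= dbar)
    (y : hilbert_sum Y m) (y_def : forall i, y i = E f (X i) + delta i)
    (lambda : R) (lambda_gt0 : 0 < lambda)
    (sstar : H) (sstar_krr : is_krr_solution E X lambda y sstar)
    (shat : H) (shat_min : is_min_norm_interpolant E X y shat) :
  let Kinv := inv_op (KXX K X) in
  let Kreg := inv_op (fun z => KXX K X z + lambda *: z) in
  [/\ forall x, E sstar x = KxX K X x (Kreg y),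
      forall x, E shat x = KxX K X x (Kinv y) &
      forall x,
        `|E sstar x - E f x| <=
          opnorm (sqrt_op (power_op K X x)) *
            Num.sqrt (Gamma ^+ 2 + Delta K X dbar y - `|shat| ^+ 2)
          + Nabla K X dbar x
          + `|KxX K X x (Kreg y - Kinv y)|].
Proof.
move=> Kinv Kreg; subst K.
have K_inv := KXX_invertible m X X_inj.
have regE x : E sstar x = KxX (kernel_of E Phi) X x (Kreg y).
  by rewrite (krr_solutionE Phi_feature lambda_gt0 sstar_krr) eval_combine.
have hat := min_norm_interpolantE Phi_feature K_inv shat_min.
split=> // x; first by rewrite {1}hat eval_combine.
have noise : noise_set dbar (y - sample E X f).
  by move=> i; rewrite !ffunE y_def addrAC subrr add0r.
have [[k_lin _] [E_lin _]] := (KxX_bounded Phi_feature X x, eval_bounded Phi_feature x).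
have Kinv_lin : linear Kinv by have [[]] := inv_opP K_inv.
(* [KXX^-1 y] is split into the parts coming from [f] and from the noise. *)
have -> : E sstar x - E f x = - E (residual E Phi X f) x
    + KxX (kernel_of E Phi) X x (Kinv (y - sample E X f))
    + KxX (kernel_of E Phi) X x (Kreg y - Kinv y).
  rewrite regE (linopB E_lin) eval_combine // (linopB Kinv_lin) !(linopB k_lin).
  rewrite -/Kinv; apply: inner_ext => w; rewrite !(innerDr, innerNr).
  by ring.
apply: le_trans (ler_normD _ _) _; rewrite lerD2r.
apply: le_trans (ler_normD _ _) _; rewrite normrN lerD ?Nabla_ge //.
have r0 := sample_residual Phi_feature K_inv f.
apply: le_trans (eval_le_power Phi_feature K_inv x r0) _.
have [[bB _ _] _] := sqrt_opP (power_op_positive Phi_feature K_inv x).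
rewrite ler_wpM2l ?opnorm_ge0 // -[leLHS]ger0_norm // -sqrtr_sqr ler_wsqrtr //.
by rewrite hat residual_energy.
Qed.
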